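(* Let $\mathcal{H}$ be a complex Hilbert space and let $S,T\in\mathcal{L}(\mathcal{H})$ be split operators such that $\|P_{T^*}(I-T)\|<1$. Then: (1) if $S\overset{*}{\leq}T$, then the $Q_T$-proper splitting of $T$ and the $Q_S$-proper splitting of $S$ converge; (2) if $S\overset{\sharp}{\leq}T$, then the $Q_T$-proper splitting of $T$ and the $Q_S$-proper splitting of $S$ converge.
   Context: $T\in\mathcal{L}(\mathcal{H})$ is a split operator if it has closed range and $\mathcal{R}(T)\dotplus\mathcal{N}(T)=\mathcal{H}$ (direct sum). $Q_T$ is the (oblique) projection onto $\mathcal{R}(T)$ along $\mathcal{N}(T)$, and $P_{T^*}$ is the orthogonal projection onto $\mathcal{R}(T^* )$. A proper splitting of a closed range operator $T$ is a decomposition $T=U-V$ with $\mathcal{R}(U)=\mathcal{R}(T)$ and $\mathcal{N}(U)=\mathcal{N}(T)$; it converges if $\rho(U^\dagger V)<1$, where $\rho$ is the spectral radius and $U^\dagger$ the Moore-Penrose inverse. The $Q_T$-proper splitting of a split operator $T$ is $T=Q_T-V$, i.e. $V=Q_T-T$. Star order: $S\overset{*}{\leq}T$ if there exist orthogonal projections $P,Q$ with $S=PT$ and $S^*=QT^*$ (one may choose $P,Q$ to be the orthogonal projections onto $\overline{\mathcal{R}(S)}$ and $\overline{\mathcal{R}(S^* )}$). Sharp order: $S\overset{\sharp}{\leq}T$ if $S=T$ or there exists a bounded idempotent $Q$ with $\mathcal{R}(Q)=\mathcal{R}(S)$, $\mathcal{N}(Q)=\mathcal{N}(S)$ and $S=QT=TQ$.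 *)

(* Defs.v *)
From HB Require Import structures.
From mathcomp Require Import all_boot all_order all_algebra.
From mathcomp Require Import all_classical all_reals all_analysis.
From mathcomp Require Import sesquilinear complex.

Set Implicit Arguments.
Unset Strict Implicit.
Unset Printing Implicit Defensive.

Import Order.TTheory GRing.Theory Num.Theory.
Import numFieldNormedType.Exports.

Local Open Scope classical_set_scope.
Local Open Scope ring_scope.
Local Open Scope complex_scope.

(* Complex Hilbert spaces: complete normed modules over R[i] whose norm comes
   from an inner product, linear in its first argument and conjugate-linear in
   the second. *)
HB.mixin Record CompleteNormedModule_isHilbert (R : realType) H
    & CompleteNormedModule R[i] H := {
  inner : {dot H for (@Num.conj R[i])};
  innerxx : forall x : H, inner x x = `|x| ^+ 2
}.

#[short(type="hilbertType")]
HB.structure Definition Hilbert (R : realType) :=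
  {H of CompleteNormedModule R[i] H & CompleteNormedModule_isHilbert R H}.

Section Operators.
Variables (R : realType) (H : hilbertType R).
Implicit Types (A B P Q S T U V X : H -> H) (M N : set H).

(* L(H), as a subset of the functions H -> H. *)
Definition bounded_op T := linear T /\ continuous T.

Definition ker T : set H := T @^-1` [set 0].

Definition direct_sum M N :=
  M `&` N = [set 0] /\
  forall z, exists x y, [/\ M x, N y & z = x + y].

Definition split_op T :=
  [/\ bounded_op T, closed (range T) & direct_sum (range T) (ker T)].

(* The operators below are unique when they exist, and are selected by xget;
   the value is 0 when no operator has the required property. *)

(* It exists for every T in L(H). *)
Definition adjoint T : H -> H :=
  xget 0 [set A | bounded_op A /\
                  forall x y : H, inner (T x) y = inner x (A y)].

Definition bounded_idempotent Q := bounded_op Q /\ Q \o Q = Q.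

Definition orth_projection P := bounded_idempotent P /\ adjoint P = P.

(* Orthogonal projection onto M; it exists for every closed subspace M. *)
Definition orth_proj_onto M : H -> H :=
  xget 0 [set P | orth_projection P /\ range P = M].

(* Oblique projection onto M along N; it exists for closed subspaces M, N with
   direct sum H. *)
Definition proj_onto_along M N : H -> H :=
  xget 0 [set Q | [/\ bounded_idempotent Q, range Q = M & ker Q = N]].

(* Oblique projection Q_T; it exists for every split operator T. *)
Definition Qproj T : H -> H := proj_onto_along (range T) (ker T).

(* The four Penrose equations; U^dagger exists for U in L(H) with closed
   range. *)
Definition moore_penrose U : H -> H :=
  xget 0 [set X | bounded_op X /\
    [/\ U \o X \o U = U, X \o U \o X = X,
        adjoint (U \o X) = U \o X & adjoint (X \o U) = X \o U]].

Local Open Scope ereal_scope.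

(* The norm of a hilbertType has values in R[i], hence the real parts. *)
Definition op_norm T : \bar R :=
  ereal_sup [set (complex.Re `|T x|%R)%:E | x in [set x : H | (`|x| <= 1)%R]].

Definition invertible_op A :=
  exists B, [/\ bounded_op B, A \o B = idfun & B \o A = idfun].

Definition spectrum A : set R[i] :=
  [set l : R[i] | ~ invertible_op (A - l *: (idfun : H -> H))%R].

(* On the zero space the spectrum is empty and this is -oo. *)
Definition spectral_radius A : \bar R :=
  ereal_sup [set (complex.Re `|l|%R)%:E | l in spectrum A].

Definition proper_splitting T U V :=
  [/\ bounded_op U, bounded_op V, T = (U - V)%R,
      range U = range T & ker U = ker T].

Definition convergent_proper_splitting T U V :=
  proper_splitting T U V /\ spectral_radius (moore_penrose U \o V) < 1.

Definition Qproj_splitting_converges T :=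
  convergent_proper_splitting T (Qproj T) (Qproj T - T)%R.

Definition star_le S T :=
  exists P Q, [/\ orth_projection P, orth_projection Q,
                  S = P \o T & adjoint S = Q \o adjoint T].

Definition sharp_le S T :=
  S = T \/
  exists Q, [/\ bounded_idempotent Q, range Q = range S, ker Q = ker S,
                S = Q \o T & S = T \o Q].

End Operators.

(* Main.v *)
(* Write [F = P_{T^*}] and [P] for the orthogonal projection onto [R(T)]. The
   Moore-Penrose inverse of the oblique projection [Q_T] is [F P], so
   [Q_T^dagger (Q_T - T) = F (I - T)]: the [Q_T]-splitting of [T] converges as
   soon as [F (I - T)] is a strict contraction. If [S] is below [T] in either
   order, then [N(T)] is contained in [N(S)], so [E = P_{S^*}] satisfies
   [E F = E], and [E (I - S)] equals [E F (I - T) E] (star order) or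
   [E F (I - T)] (sharp order); hence [S] inherits the bound of [T].

   That these (pseudo-)inverses and projections exist as bounded operators rests
   on the closed range theorem: weakly bounded sets are bounded, so [T^*] is
   bounded below on [R(T)], whence its range is closed; applied to [F P], the
   same argument bounds [Q_T]. *)
Require Import Defs.
From HB Require Import structures.
From mathcomp Require Import all_boot all_order all_algebra.
From mathcomp Require Import all_classical all_reals all_analysis.
From mathcomp Require Import sesquilinear complex ring lra.

Set Implicit Arguments.
Unset Strict Implicit.
Unset Printing Implicit Defensive.

Import Order.TTheory GRing.Theory Num.Theory.
Import numFieldNormedType.Exports.

Local Open Scope classical_set_scope.
Local Open Scope ring_scope.
Local Open Scope complex_scope.

(** * Linear maps given as plain functions *)

Section LinearFacts.
Variables (K : pzRingType) (U V : lmodType K) (T : U -> V).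
Hypothesis lT : linear T.

Lemma lin0 : T 0 = 0.
Proof. by have := lT (-1) 0 0; rewrite !scaleN1r oppr0 addr0 addNr. Qed.

Lemma linD x y : T (x + y) = T x + T y.
Proof. by rewrite -[x]scale1r lT !scale1r. Qed.

Lemma linZ a x : T (a *: x) = a *: T x.
Proof. by rewrite -[a *: x]addr0 lT lin0 addr0. Qed.

Lemma linN x : T (- x) = - T x.
Proof. by rewrite -!scaleN1r linZ. Qed.

Lemma linB x y : T (x - y) = T x - T y.
Proof. by rewrite linD linN. Qed.

End LinearFacts.

(** * Real-valued norm and inner product, and geometric convergence *)

Section RealStructure.
Variables (R : realType) (H : hilbertType R).
Implicit Types (x y z : H) (t : R).

(** The norm and the inner product take values in [R[i]]; their real parts allow all order estimates
    to be made in [R]. *)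
Definition nrm x : R := complex.Re `|x|.
Definition rip x y : R := complex.Re (inner x y).

Lemma norm_nrm x : `|x| = (nrm x)%:C.
Proof. by rewrite /nrm RRe_real// normr_real. Qed.

Lemma Re_normc (c : R[i]) : `|c| = (complex.Re `|c|)%:C.
Proof. by rewrite RRe_real// normr_real. Qed.

Lemma ReM (a b : R[i]) : complex.Re (a * b) =
  complex.Re a * complex.Re b - complex.Im a * complex.Im b.
Proof. by case: a b => [? ?] []. Qed.

Lemma nrm_ge0 x : 0 <= nrm x.
Proof. by rewrite -ler0c -norm_nrm. Qed.

(** Cancels a factor that may vanish: [nrm v ^+ 2 <= nrm v * b] becomes [nrm v <= b] without a case
    split. *)
Lemma le_of_sqr_le (a b : R) : 0 <= b -> a ^+ 2 <= a * b -> a <= b.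
Proof. by move=> b0 ab; rewrite leNgt; apply/negP => ba; nra. Qed.

Lemma nrm0 : nrm 0 = 0.
Proof. by rewrite /nrm normr0. Qed.

Lemma nrm0_eq0 x : nrm x = 0 -> x = 0.
Proof. by move=> x0; apply/eqP; rewrite -normr_eq0 norm_nrm x0. Qed.

Lemma nrmN x : nrm (- x) = nrm x.
Proof. by rewrite /nrm normrN. Qed.

Lemma nrmB x y : nrm (x - y) = nrm (y - x).
Proof. by rewrite -nrmN opprB. Qed.

Lemma nrmD x y : nrm (x + y) <= nrm x + nrm y.
Proof. by rewrite -lecR raddfD/= -!norm_nrm ler_normD. Qed.

Lemma nrmZ (c : R[i]) x : nrm (c *: x) = complex.Re `|c| * nrm x.
Proof.
apply: (@complexI R); rewrite -norm_nrm normrZ rmorphM/= -norm_nrm.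
by rewrite -Re_normc.
Qed.

Lemma nrmZr t x : nrm (t%:C *: x) = `|t| * nrm x.
Proof. by rewrite nrmZ normc_def/= expr0n/= addr0 sqrtr_sqr. Qed.

Lemma innerC x y : inner x y = conjc (inner y x).
Proof. by rewrite hermC expr0 mul1r. Qed.

Lemma ripC x y : rip x y = rip y x.
Proof. by rewrite /rip innerC; case: (inner y x). Qed.

Lemma ripDl x y z : rip (x + y) z = rip x z + rip y z.
Proof. by rewrite /rip linearDl raddfD. Qed.

Lemma ripDr x y z : rip x (y + z) = rip x y + rip x z.
Proof. by rewrite ripC ripDl !(ripC x). Qed.

Lemma ripNl x y : rip (- x) y = - rip x y.
Proof. by rewrite /rip linearNl raddfN. Qed.

Lemma ripNr x y : rip x (- y) = - rip x y.
Proof. by rewrite ripC ripNl ripC. Qed.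

Lemma ripBl x y z : rip (x - y) z = rip x z - rip y z.
Proof. by rewrite ripDl ripNl. Qed.

Lemma ripBr x y z : rip x (y - z) = rip x y - rip x z.
Proof. by rewrite ripDr ripNr. Qed.

Lemma ripZl t x y : rip (t%:C *: x) y = t * rip x y.
Proof. by rewrite /rip linearZl_LR/= ReM/= mul0r subr0. Qed.

Lemma ripZr t x y : rip x (t%:C *: y) = t * rip x y.
Proof. by rewrite ripC ripZl ripC. Qed.

Lemma ripxx x : rip x x = nrm x ^+ 2.
Proof. by rewrite /rip innerxx norm_nrm -rmorphXn. Qed.

(** The imaginary part of [c] is the real part of [-i c], so [rip] determines [inner]. *)
Lemma inner_rip x y : inner x y = rip x y +i* rip ((- 'i%C) *: x) y.
Proof.
rewrite /rip linearZl_LR/= ReM/= oppr0 mul0r sub0r mulNr mul1r opprK.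
by case: (inner x y).
Qed.

Lemma nrmD_sqr x y : nrm (x + y) ^+ 2 = nrm x ^+ 2 + 2 * rip x y + nrm y ^+ 2.
Proof. by rewrite -!ripxx !ripDl !ripDr (ripC y x); ring. Qed.

Lemma nrmB_sqr x y : nrm (x - y) ^+ 2 = nrm x ^+ 2 - 2 * rip x y + nrm y ^+ 2.
Proof. by rewrite nrmD_sqr nrmN ripNr; ring. Qed.

Lemma rip_le x y : rip x y <= nrm x * nrm y.
Proof.
have x0 := nrm_ge0 x; have y0 := nrm_ge0 y.
have [->|yn0] := eqVneq y 0; first by rewrite /rip linear0r nrm0 mulr0.
have [->|xn0] := eqVneq x 0; first by rewrite /rip linear0l nrm0 mul0r.
have xgt0 : 0 < nrm x.
  by rewrite lt_neqAle x0 andbT eq_sym; apply: contra_neq xn0 => /nrm0_eq0.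
have ygt0 : 0 < nrm y.
  by rewrite lt_neqAle y0 andbT eq_sym; apply: contra_neq yn0 => /nrm0_eq0.
(* Cauchy-Schwarz: this square expands to [2 * nrm x * nrm y * (nrm x * nrm y - rip x y)]. *)
have := sqr_ge0 (nrm ((nrm y)%:C *: x - (nrm x)%:C *: y)).
rewrite nrmB_sqr ripZl ripZr !nrmZr !ger0_norm//.
move=> h; have {}h : 0 <= nrm x * nrm y * (nrm x * nrm y - rip x y) by lra.
by rewrite pmulr_rge0 ?mulr_gt0// subr_ge0 in h.
Qed.

Lemma rip_eq x y : (forall z, rip z x = rip z y) -> x = y.
Proof.
move=> xy; apply/eqP; rewrite -subr_eq0; apply/eqP/nrm0_eq0/eqP.
by rewrite -sqrf_eq0 -ripxx ripBr xy subrr.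
Qed.

Lemma inner_eq x y : (forall z, inner z x = inner z y) -> x = y.
Proof. by move=> xy; apply: rip_eq => z; rewrite /rip xy. Qed.

(** Balls in [H] have radii in [R[i]]; a positive radius there is real. *)
Lemma closedP_nrm (M : set H) : closed M <->
  forall x, (forall e : R, 0 < e -> exists2 y, M y & nrm (x - y) < e) -> M x.
Proof.
split=> [clM x Mx|clM].
  apply: clM => B /nbhs_normP[e /= e0 eB].
  have eR : 0 < complex.Re e by move: e0; rewrite ltcE => /andP[].
  have [y My xy] := Mx _ eR.
  exists y; split => //; apply: eB => /=.
  have -> : e = (complex.Re e)%:C by rewrite RRe_real// gtr0_real.
  by rewrite norm_nrm ltcR.
move=> x Mx; apply: clM => e e0.
have [y [My xy]] := Mx _ (nbhsx_ballx x e%:C ltac:(by rewrite ltcR)).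
by exists y => //; move: xy; rewrite -ball_normE/= norm_nrm ltcR.
Qed.

Lemma continuousP_nrm (T : H -> H) : linear T ->
  continuous T <-> exists2 C : R, 0 <= C & forall x, nrm (T x) <= C * nrm x.
Proof.
move=> lT; pose f : {linear H -> H} :=
  HB.pack T (GRing.isLinear.Build _ _ _ _ _ lT).
have -> : continuous T <-> bounded_near f (nbhs (0 : H)).
  by split => /(linear_bounded_continuous f).
rewrite linear_boundedP; split.
  move=> /pinfty_ex_gt0[r r0 fr]; exists (complex.Re r).
    by move: r0; rewrite ltcE => /andP[_ /ltW].
  by move=> x; rewrite -lecR rmorphM/= -!norm_nrm RRe_real ?gtr0_real//.
move=> [C C0 TC]; exists C%:C; split; first by rewrite ger0_real// ler0c.
move=> r Cr x; apply: le_trans (_ : (C * nrm x)%:C <= _).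
  by rewrite norm_nrm lecR TC.
by rewrite rmorphM/= norm_nrm ler_wpM2r ?lecR ?nrm_ge0// ltW.
Qed.

Lemma bounded_opP (T : H -> H) : bounded_op T <->
  linear T /\ exists2 C : R, 0 <= C & forall x, nrm (T x) <= C * nrm x.
Proof.
by split=> -[lT bT]; split=> //; apply/continuousP_nrm.
Qed.

Lemma geometric_small (K q e : R) : 0 <= q < 1 -> 0 < e ->
  exists n, K * q ^+ n < e.
Proof.
move=> /andP[q0 q1] e0.
have : (fun n => K * q ^+ n) @ \oo --> (0 : R).
  by apply: (@cvg_geometric R K q); rewrite ger0_norm.
move=> /cvgrPdist_lt/(_ e e0)[n _ /(_ n (leqnn n))/=].
by rewrite sub0r normrN => /(le_lt_trans (ler_norm _)) h; exists n.
Qed.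

(** Takes the place of passing to the limit in the estimates below. *)
Lemma le0_small (a K q : R) : 0 <= q < 1 ->
  (forall n, a <= K * q ^+ n) -> a <= 0.
Proof.
move=> q01 aK; rewrite leNgt; apply/negP => a0.
have [n] := geometric_small K q01 a0.
by rewrite ltNge aK.
Qed.

(** Increments bounded by a geometric sequence make [u] Cauchy; the explicit rate is what later
    arguments use. *)
Lemma geometric_cvg (u : nat -> H) (K q : R) : 0 <= K -> 0 <= q < 1 ->
  (forall n, nrm (u n.+1 - u n) <= K * q ^+ n) ->
  exists l, forall n, nrm (l - u n) <= K / (1 - q) * q ^+ n.
Proof.
move=> K0 q01 uK; have /andP[q0 q1] := q01.
have q1' : 0 < 1 - q by rewrite subr_gt0.
(* Each term is a difference of consecutive tails of the geometric series, so the sum of the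
   increments telescopes. *)
have KE n : K * q ^+ n = K / (1 - q) * q ^+ n - K / (1 - q) * q ^+ n.+1.
  by rewrite exprS; field; rewrite gt_eqF.
have uS n k : nrm (u (n + k)%N - u n) <=
    K / (1 - q) * q ^+ n - K / (1 - q) * q ^+ (n + k).
  elim: k => [|k ih]; first by rewrite addn0 !subrr nrm0.
  rewrite addnS -(subrK (u (n + k)%N) (u _.+1)) -addrA.
  apply: le_trans (nrmD _ _) _.
  by have := uK (n + k)%N; rewrite KE; lra.
have uC n k : nrm (u (n + k)%N - u n) <= K / (1 - q) * q ^+ n.
  apply: le_trans (uS n k) _; rewrite gerBl mulr_ge0 ?exprn_ge0//.
  by rewrite divr_ge0// ltW.
have : cvg (u @ \oo).
  apply: cauchy_cvg; apply: cauchy_exP => e e0.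
  have eR : e = (complex.Re e)%:C by rewrite RRe_real// gtr0_real.
  have [n Kn] : exists n, K / (1 - q) * q ^+ n < complex.Re e.
    by apply: geometric_small => //; rewrite -ltcR -eR.
  exists (u n); exists n => // m /= nm.
  rewrite -ball_normE/= eR norm_nrm ltcR nrmB.
  by apply: le_lt_trans Kn; rewrite -(subnKC nm).
move=> /cvg_ex[l ul]; exists l => n; apply/ler_addgt0Pr => e e0.
have /cvgrPdist_lt/(_ e%:C)[|m _ um] := ul; first by rewrite ltcR.
have := um (n + m)%N (leq_addl _ _); rewrite /= norm_nrm ltcR => le.
rewrite -(subrK (u (n + m)%N) l) -addrA addrC.
apply: le_trans (nrmD _ _) _; apply: lerD (ltW le); exact: uC.
Qed.

End RealStructure.

(** * Orthogonal projections, Riesz representation and adjoints *)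

Section Projections.
Variables (R : realType) (H : hilbertType R).
Implicit Types (x y z : H) (M : set H) (T A P : H -> H).

Definition is_subspace M :=
  M 0 /\ forall (a : R[i]) x y, M x -> M y -> M (a *: x + y).

(** Relational form of $A=T^*$, free of the choice made by [xget] and symmetric in the two maps. *)
Definition adjoint_pair T A :=
  [/\ bounded_op T, bounded_op A & forall x y, inner (T x) y = inner x (A y)].

Definition sym_idempotent P :=
  [/\ bounded_op P, forall x, P (P x) = P x &
      forall x y, inner (P x) y = inner x (P y)].

Lemma subspaceZ M a x : is_subspace M -> M x -> M (a *: x).
Proof. by move=> [M0 MD] Mx; rewrite -[_ *: _]addr0; exact: MD. Qed.

Lemma subspaceB M x y : is_subspace M -> M x -> M y -> M (x - y).
Proof. by move=> [M0 MD] Mx My; rewrite addrC -scaleN1r; exact: MD. Qed.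

Lemma range_subspace T : linear T -> is_subspace (range T).
Proof.
move=> lT; split=> [|a _ _ [x _ <-] [y _ <-]]; first by exists 0; rewrite ?lin0.
by exists (a *: x + y); rewrite ?lT.
Qed.

(** [M] is stable under multiplication by [-i], so the imaginary parts vanish along with the real
    ones. *)
Lemma inner_sub_eq0 M z : is_subspace M ->
  (forall m, M m -> rip m z = 0) -> forall m, M m -> inner m z = 0.
Proof.
by move=> sM Mz m Mm; rewrite inner_rip !Mz//; exact: subspaceZ.
Qed.

(** A minimizing sequence for the distance converges by the parallelogram identity, and perturbing
    it along [m] shows that the limit leaves a residual orthogonal to [M]. *)
Lemma nearest_point M x : is_subspace M -> closed M ->
  exists2 p, M p & forall m, M m -> inner m (x - p) = 0.
Proof.
move=> sM /closedP_nrm clM; have [M0 MD] := sM.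
pose D := [set nrm (x - m) ^+ 2 | m in M]; pose d := inf D.
have infD : has_inf D.
  split; first by exists (nrm (x - 0) ^+ 2), 0.
  by exists 0 => _ [m _ <-]; exact: sqr_ge0.
have dM m : M m -> d <= nrm (x - m) ^+ 2.
  by move=> Mm; apply: ge_inf; [exact: infD.2 | exists m].
(* With squared distances within [s n ^+ 2] of the infimum, consecutive terms differ by at most
   [2 * s n], and a perturbation of size [s n] leaves an error of order [s n]. *)
pose s n : R := 4^-1 ^+ n.
have s_gt0 n : 0 < s n by rewrite exprn_gt0// invr_gt0.
have sS n : s n.+1 = 4^-1 * s n by rewrite /s exprS.
have /choice[u uP] : forall n, exists m, M m /\ nrm (x - m) ^+ 2 < d + s n ^+ 2.
  move=> n; have [|_ [m Mm <-] lt] := @inf_adherent _ D (s n ^+ 2) _ infD.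
    by rewrite exprn_gt0.
  by exists m.
have uM n := (uP n).1; have ud n := (uP n).2.
have uS n : nrm (u n.+1 - u n) <= 2 * 4^-1 ^+ n.
  rewrite -(ler_pXn2r (ltn0Sn 1)) ?nnegrE ?nrm_ge0 ?mulr_ge0 ?ltW ?s_gt0//.
  have -> : u n.+1 - u n = (x - u n) - (x - u n.+1).
    by rewrite opprB [RHS]addrC addrA subrK.
  (* The midpoint lies in [M], so its squared distance to [x] is at least [d]; this bounds the other
     diagonal of the parallelogram. *)
  pose m := (2^-1)%:C *: (u n - 0) + (2^-1)%:C *: u n.+1.
  have mM : M m.
    rewrite /m subr0; apply: MD => //; exact: subspaceZ.
  have := dM _ mM.
  have -> : x - m = (2^-1)%:C *: ((x - u n) + (x - u n.+1)).
    rewrite addrACA scalerDr scalerDr -scalerDl -rmorphD/=.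
    have -> : 2^-1 + 2^-1 = 1 :> R by field.
    by rewrite scale1r -opprD scalerN /m subr0 scalerDr.
  rewrite nrmZr exprMn ger0_norm ?invr_ge0// (nrmD_sqr (x - u n)).
  rewrite (nrmB_sqr (x - u n)) -/(s n).
  have := ud n; have := ud n.+1; rewrite sS; have := s_gt0 n.
  by nra.
pose q : R := 4^-1; have q01 : 0 <= q < 1 by apply/andP; rewrite /q; split; lra.
have [l ul] := geometric_cvg (ler0n R 2) q01 uS.
set K := 2 / _ in ul; have K0 : 0 <= K.
  by rewrite divr_ge0// subr_ge0 ltW//; case/andP: q01.
exists l.
  apply: clM => e e0; have [n Kn] := geometric_small K q01 e0.
  by exists (u n) => //; exact: le_lt_trans (ul n) Kn.
have le0 m : M m -> rip m (x - l) <= 0.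
  move=> Mm; pose B := (1 + nrm m ^+ 2) / 2 + nrm m * K.
  apply: (@le0_small R _ B _ q01) => n; rewrite /B.
  have h1 : 2 * rip m (x - u n) <= s n * (1 + nrm m ^+ 2).
    (* Compare [u n] with its translate by [s n] times [m]; dividing by [s n] gives the first-order
       inequality. *)
    have := dM _ (MD (s n)%:C _ _ Mm (uM n)).
    have -> : x - ((s n)%:C *: m + u n) = (x - u n) - (s n)%:C *: m.
      by rewrite opprD addrA addrAC.
    rewrite (nrmB_sqr (x - u n)) ripZr nrmZr exprMn ripC.
    rewrite (ger0_norm (ltW (s_gt0 n))).
    have := ud n; have := s_gt0 n => sn udn dn.
    have : s n * (2 * rip m (x - u n)) <= s n * (s n * (1 + nrm m ^+ 2)) by nra.
    by rewrite ler_pM2l.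
  have h2 : rip m (u n - l) <= nrm m * (K * s n).
    apply: le_trans (rip_le _ _) _; apply: ler_wpM2l; first exact: nrm_ge0.
    by rewrite nrmB.
  have -> : x - l = (x - u n) + (u n - l) by rewrite addrA subrK.
  by rewrite ripDr -/(s n); nra.
apply: inner_sub_eq0 => // m Mm; apply/eqP; rewrite eq_le le0//=.
by rewrite -oppr_le0 -ripNl le0// -scaleN1r; exact: subspaceZ.
Qed.

(** Here $\|Px\|^2=\langle x,Px\rangle$. Being stated for bare functions, it can supply the
    boundedness of a projection under construction. *)
Lemma contractive_of_symmetric_idempotent P x :
  (forall y, P (P y) = P y) -> (forall y z, inner (P y) z = inner y (P z)) ->
  nrm (P x) <= nrm x.
Proof.
move=> PP Ps; apply: le_of_sqr_le; first exact: nrm_ge0.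
by rewrite -ripxx /rip Ps PP -/(rip x (P x)) mulrC; exact: rip_le.
Qed.

Lemma sym_idempotent_nrm P x : sym_idempotent P -> nrm (P x) <= nrm x.
Proof.
by move=> [_ PP Ps]; exact: contractive_of_symmetric_idempotent.
Qed.

Lemma orth_proj_exists M : is_subspace M -> closed M ->
  exists2 P, sym_idempotent P & range P = M.
Proof.
move=> sM clM; have [M0 MD] := sM.
have /choice[P hP] x :
    exists p, M p /\ forall m, M m -> inner m (x - p) = 0.
  by have [p Mp hp] := nearest_point x sM clM; exists p.
have PM x := (hP x).1; have Po x := (hP x).2.
(* Uniqueness of the orthogonal decomposition; linearity of [P] follows from it. *)
have Puniq x p : M p -> (forall m, M m -> inner m (x - p) = 0) -> P x = p.
  move=> Mp op; apply/eqP; rewrite -subr_eq0; apply/eqP/nrm0_eq0/eqP.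
  have Mpp : M (P x - p) by exact: subspaceB.
  rewrite -sqrf_eq0 -ripxx /rip.
  have {2}-> : P x - p = (x - p) - (x - P x).
    by rewrite opprB [RHS]addrC addrA subrK.
  by rewrite linearBr/= op// Po// subrr.
have Pid m : M m -> P m = m.
  by move=> Mm; apply: Puniq => // m' _; rewrite subrr linear0r.
have lP : linear P.
  move=> a x y; apply: Puniq => [|m Mm]; first exact: MD.
  rewrite opprD addrACA -scalerBr linearDr linearZr_LR/=.
  by rewrite !Po// mulr0 addr0.
have Psym x y : inner (P x) y = inner x (P y).
  have -> : inner (P x) y = inner (P x) (P y).
    by rewrite -[y in LHS](subrK (P y)) linearDr/= Po// add0r.
  rewrite -[x in RHS](subrK (P x)) linearDl/=.
  by rewrite (innerC (x - _)) Po// conjc0 add0r.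
exists P; last first.
  by apply/seteqP; split=> [_ [x _ <-]//|m Mm]; exists m; rewrite ?Pid.
split=> // [|x]; last exact/Pid.
apply/bounded_opP; split=> //; exists 1 => // x; rewrite mul1r.
by apply: contractive_of_symmetric_idempotent => // y; exact/Pid.
Qed.

(** The kernel is closed; a vector [w] orthogonal to it, suitably scaled, represents [f]. *)
Lemma riesz (f : H -> R[i]) (C : R) :
  (forall a x y, f (a *: x + y) = a * f x + f y) ->
  (forall x, complex.Re (f x) <= C * nrm x) ->
  exists y, forall x, f x = inner x y.
Proof.
move=> lf bf.
have f0 : f 0 = 0 by rewrite -(addNr 0) -scaleN1r lf mulN1r addNr.
have fD x y : f (x + y) = f x + f y by rewrite -[x]scale1r lf mul1r scale1r.
have fZ a x : f (a *: x) = a * f x by rewrite -[_ *: _]addr0 lf f0 addr0.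
have fB x y : f (x - y) = f x - f y by rewrite fD -scaleN1r fZ mulN1r.
pose N := [set x | f x = 0].
have sN : is_subspace N.
  by split=> // a x y; rewrite /N/= lf => -> ->; rewrite mulr0 addr0.
have clN : closed N.
  apply/closedP_nrm => x xN.
  (* Only real parts of [f] are bounded, hence the free scalar [a]: the choice $a=\overline{f(x)}$
     turns this into $|f(x)|^2\le 0$. *)
  have Re0 a : complex.Re (f (a *: x)) <= 0.
    apply/ler_addgt0Pr => e e0; rewrite add0r.
    (* The summand 1 keeps [k] positive when [C] or [a] is zero. *)
    pose k := `|C| * complex.Re `|a| + 1.
    have k0 : 0 < k.
      by rewrite ltr_wpDl// mulr_ge0// -ler0c -Re_normc.
    have [|y Ny xy] := xN (e / k); first by rewrite divr_gt0.
    have -> : f (a *: x) = f (a *: (x - y)) by rewrite !fZ fB Ny subr0.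
    apply: le_trans (bf _) _; rewrite nrmZ.
    have a0 : 0 <= complex.Re `|a| by rewrite -ler0c -Re_normc.
    rewrite ltr_pdivlMr// in xy.
    have := nrm_ge0 (x - y) => n0.
    have Ca : C * (complex.Re `|a| * nrm (x - y)) <=
              `|C| * (complex.Re `|a| * nrm (x - y)).
      by apply: ler_wpM2r; [rewrite mulr_ge0 | exact: ler_norm].
    by rewrite /k in xy; lra.
  have := Re0 (conjc (f x)); rewrite fZ mulrC -sqr_normc.
  rewrite {1}Re_normc -rmorphXn/= => h; apply/eqP.
  have : (complex.Re `|f x|) ^+ 2 == 0 by rewrite eq_le h sqr_ge0.
  by rewrite sqrf_eq0 -(normr_eq0 (f x)) => /eqP e; rewrite Re_normc e.
have [fx0|/existsNP[x0 /eqP fx0]] := pselect (forall x, f x = 0).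
  by exists 0 => x; rewrite fx0 linear0r.
have [p Np op] := nearest_point x0 sN clN.
pose w := x0 - p; have fw : f w = f x0 by rewrite fB Np subr0.
have iww : inner w w != 0.
  rewrite innerxx sqrf_eq0 normr_eq0; apply: contra_neq fx0 => w0.
  by rewrite -fw w0.
exists (conjc (f w / inner w w) *: w) => x.
rewrite linearZr_LR/= -[Num.conj _]/(conjc (conjc _)) conjcK.
have : inner (x - (f x / f w) *: w) w = 0.
  by apply: op; rewrite /N/= fB fZ divfK ?fw// subrr.
rewrite linearBl linearZl_LR/= => /eqP; rewrite subr_eq0 => /eqP ->.
by field; rewrite iww fw fx0.
Qed.

(** [A y] is the Riesz vector of $x\mapsto\langle Tx,y\rangle$; its bound comes from
    $\|Ay\|^2=\langle TAy,y\rangle$. *)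
Lemma adjoint_exists T : bounded_op T -> exists A, adjoint_pair T A.
Proof.
move=> bT; have [lT [C C0 TC]] := (bounded_opP T).1 bT.
have /choice[A hA] : forall y, exists z, forall x, inner (T x) y = inner x z.
  move=> y; apply: (@riesz _ (C * nrm y)) => [a u v|x].
    by rewrite lT linearDl linearZl_LR.
  apply: le_trans (rip_le _ _) _; rewrite mulrAC.
  by apply: ler_wpM2r (TC x); exact: nrm_ge0.
exists A; split=> //; apply/bounded_opP; split=> [a y z|].
  apply: inner_eq => x.
  by rewrite -hA !linearDr !linearZr_LR/= !hA.
exists C => // y.
apply: le_of_sqr_le; first by rewrite mulr_ge0 ?nrm_ge0.
rewrite -ripxx /rip -hA -/(rip (T (A y)) y).
apply: le_trans (rip_le _ _) _; rewrite mulrCA mulrA.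
by apply: ler_wpM2r; [exact: nrm_ge0 | exact: TC].
Qed.

Lemma adjoint_pair_uniq T A B : adjoint_pair T A -> adjoint_pair T B -> A = B.
Proof.
move=> [_ _ TA] [_ _ TB]; apply/funext => y; apply: inner_eq => x.
by rewrite -TA TB.
Qed.

Lemma adjoint_pairC T A : adjoint_pair T A -> adjoint_pair A T.
Proof.
by move=> [bT bA TA]; split=> // x y; rewrite innerC -TA -innerC.
Qed.

Lemma adjointP T : bounded_op T -> adjoint_pair T (adjoint T).
Proof.
move=> bT; have [A [_ bA TA]] := adjoint_exists bT.
by have [] := xgetPex (0 : H -> H) (ex_intro
  [set A | bounded_op A /\ forall x y : H, inner (T x) y = inner x (A y)]
  A (conj bA TA)).
Qed.

Lemma adjointE T A : adjoint_pair T A -> adjoint T = A.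
Proof.
by move=> TA; apply: adjoint_pair_uniq (TA); apply: adjointP; case: TA.
Qed.

Lemma self_adjointP T : bounded_op T ->
  adjoint T = T <-> forall x y, inner (T x) y = inner x (T y).
Proof.
move=> bT; split=> [TT|TT]; last exact: adjointE.
by have [_ _] := adjointP bT; rewrite TT.
Qed.

Lemma orth_projectionP P : orth_projection P <-> sym_idempotent P.
Proof.
split=> [[[bP PP] /(self_adjointP bP) Ps]|[bP PP Ps]].
  by split=> // x; rewrite -[in RHS]PP.
split; last exact/self_adjointP.
by split=> //; apply/funext => x; exact: PP.
Qed.

Lemma orth_proj_ontoP M : is_subspace M -> closed M ->
  sym_idempotent (orth_proj_onto M) /\ range (orth_proj_onto M) = M.
Proof.
move=> sM clM; have [P /orth_projectionP hP PM] := orth_proj_exists sM clM.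
by have [/orth_projectionP] := xgetPex (0 : H -> H) (ex_intro
  [set P | orth_projection P /\ range P = M] P (conj hP PM)).
Qed.

End Projections.

(** * Uniform boundedness and the closed range theorem *)

Section ClosedRange.
Variables (R : realType) (H : hilbertType R).
Implicit Types (x y z : H) (M : set H) (T A P E F Q X : H -> H).

(* Uniform boundedness by a gliding hump: the steps of length [r n] towards
   [y n] or away from it keep [rip (y n) l] of size at least
   [r n * nrm (y n) / 2] at the limit [l]. *)
Lemma weakly_bounded_bounded (B : set H) :
  (forall z, exists C : R, forall y, B y -> rip y z <= C) ->
  exists C : R, forall y, B y -> nrm y <= C.
Proof.
move=> wB; apply: contrapT => /forallNP nB.
pose r n : R := 3^-1 ^+ n.+1.
have r_gt0 n : 0 < r n by rewrite exprn_gt0// invr_gt0.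
(* The threshold makes [r n * nrm (y n) / 2] exceed [n]. *)
have /choice[y yP] n : exists y, B y /\ 2 * n%:R / r n < nrm y.
  have /existsNP[y /not_implyP[By /negP]] := nB (2 * n%:R / r n).
  by rewrite -ltNge; exists y.
have y_gt0 n : 0 < nrm (y n).
  by apply: le_lt_trans (yP n).2; rewrite divr_ge0 ?mulr_ge0 ?(ltW (r_gt0 n)).
pose sg (b : bool) : R := if b then 1 else -1.
pose step n x := (sg (0 <= rip (y n) x) * (r n / nrm (y n)))%:C *: y n + x.
pose u := fix u n := if n is m.+1 then step m (u m) else 0.
have uS n : nrm (u n.+1 - u n) <= 3^-1 * 3^-1 ^+ n.
  have sg1 b : `|sg b| = 1 by case: b; rewrite /sg ?normrN normr1.
  have rn0 : 0 <= r n / nrm (y n) by rewrite divr_ge0 ?ltW.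
  rewrite /= /step addrK nrmZr normrM sg1 mul1r (ger0_norm rn0).
  by rewrite divfK ?gt_eqF// -exprS.
pose q : R := 3^-1; have q01 : 0 <= q < 1 by apply/andP; rewrite /q; split; lra.
have [|l ul] := geometric_cvg _ q01 uS; first by rewrite invr_ge0.
(* With ratio 1/3, all later steps together have at most half the length of step [n], so they cannot
   undo it. *)
have lu n : nrm (l - u n.+1) <= r n / 2.
  apply: le_trans (ul n.+1) _; rewrite /q -/(r n) mulrC.
  suff -> : 3^-1 / (1 - 3^-1) = 2^-1 :> R by [].
  by field.
have yl n : n%:R < `|rip (y n) l|.
  have yn := y_gt0 n; have rn := r_gt0 n.
  have h1 : r n * nrm (y n) <= `|rip (y n) (u n.+1)|.
    rewrite /= /step ripDr ripZr ripxx -mulrA.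
    have -> : r n / nrm (y n) * nrm (y n) ^+ 2 = r n * nrm (y n).
      by field; rewrite gt_eqF.
    have p0 : 0 < r n * nrm (y n) by rewrite mulr_gt0.
    rewrite /sg; case: (leP 0 (rip (y n) (u n))) => h; rewrite ?mul1r ?mulN1r.
      by rewrite ler_normr; apply/orP; left; lra.
    by rewrite ler_normr; apply/orP; right; lra.
  have h2 : `|rip (y n) (l - u n.+1)| <= nrm (y n) * (r n / 2).
    have le v : nrm v <= r n / 2 -> rip (y n) v <= nrm (y n) * (r n / 2).
      move=> vr; apply: le_trans (rip_le _ _) _.
      by apply: ler_wpM2l vr; exact: nrm_ge0.
    by rewrite ler_norml lerNl -ripNr !le// nrmN.
  have h3 : 2 * n%:R < nrm (y n) * r n.
    by rewrite -ltr_pdivrMr//; exact: (yP n).2.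
  have := ler_normB (rip (y n) l) (rip (y n) l - rip (y n) (u n.+1)).
  by rewrite subKr -ripBr; lra.
have [C1 h1] := wB l; have [C2 h2] := wB (- l).
pose C := `|C1| + `|C2|; pose n := (Num.truncn C).+1.
have : `|rip (y n) l| <= C.
  have := h1 _ (yP n).1; have := h2 _ (yP n).1; rewrite ripNr => a b.
  rewrite ler_norml; apply/andP; rewrite /C.
  have := ler_norm C1; have := ler_norm C2.
  have := normr_ge0 C1; have := normr_ge0 C2.
  by split; lra.
by apply/negP; rewrite -ltNge (lt_trans _ (yl n))// /n truncnS_gt.
Qed.

Lemma inner_eq0 x : (forall y, inner x y = 0) -> x = 0.
Proof.
by move=> /(_ x); rewrite innerxx => /eqP; rewrite sqrf_eq0 normr_eq0 => /eqP.
Qed.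

(** [x - Q x] lies in the kernel of [Q], hence in that of [E]. *)
Lemma absorb_idempotent E Q x : linear E -> linear Q ->
  (forall z, Q (Q z) = Q z) -> (forall z, Q z = 0 -> E z = 0) ->
  E (Q x) = E x.
Proof.
move=> lE lQ QQ QE; apply/eqP; rewrite -subr_eq0 -linB//; apply/eqP/QE.
by rewrite linB// QQ subrr.
Qed.

(** Equal kernels give $EF=E$ and $FE=F$; the adjoint of the latter is $EF=F$. *)
Lemma sym_idempotent_uniq E F : sym_idempotent E -> sym_idempotent F ->
  (forall x, E x = 0 <-> F x = 0) -> E = F.
Proof.
move=> [[lE _] EE Es] [[lF _] FF Fs] EF; apply/funext => x.
apply: inner_eq => y.
rewrite -(@absorb_idempotent E F x)//; last by move=> z /EF.
by rewrite -Es -Fs (@absorb_idempotent F E y)// => z /EF.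
Qed.

(** Both kernels are the orthogonal complement of $R(A)$. *)
Lemma sym_idempotent_ker T A E x : adjoint_pair T A -> sym_idempotent E ->
  range E = range A -> E x = 0 <-> T x = 0.
Proof.
move=> [_ _ TA] [_ _ Es] EA; split=> x0; apply: inner_eq0 => y.
  have [z _ Ez] : range E (A y) by rewrite EA; exists y.
  by rewrite TA -Ez -Es x0 linear0l.
have [z _ Az] : range A (E y) by rewrite -EA; exists y.
by rewrite Es -Az -TA x0 linear0l.
Qed.

Lemma range_idempotent P y : (forall x, P (P x) = P x) -> range P y -> P y = y.
Proof. by move=> PP [x _ <-]. Qed.

(** The [y] in $R(T)$ with $\|Ay\|\le 1$ form a weakly bounded set: with $Pz=Tx$, $\langle
    y,z\rangle=\langle y,Tx\rangle=\langle Ay,x\rangle$. Uniform boundedness and scaling give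
    [c]. *)
Lemma adjoint_bounded_below T A : adjoint_pair T A -> closed (range T) ->
  exists2 c : R, 0 <= c & forall y, range T y -> nrm y <= c * nrm (A y).
Proof.
move=> [bT bA TA] clT; have lT := bT.1; have lA := bA.1.
have [P [_ PP Ps] PT] := orth_proj_exists (range_subspace lT) clT.
pose B := [set y | range T y /\ nrm (A y) <= 1].
have [|C BC] := @weakly_bounded_bounded B.
  move=> z; have [x _ Tx] : range T (P z) by rewrite -PT; exists z.
  exists (nrm x) => y [Ty Ay].
  have -> : rip y z = rip x (A y).
    have Py : P y = y by apply: range_idempotent; rewrite ?PT.
    by rewrite /rip -TA Tx -{1}Py Ps -/(rip _ _) ripC.
  apply: le_trans (rip_le _ _) _; rewrite -[leRHS]mulr1.
  by apply: ler_wpM2l Ay; exact: nrm_ge0.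
exists `|C| => // y Ty; have [Ay0|Ayn0] := eqVneq (nrm (A y)) 0.
  have [x _ Tx] := Ty; have := nrm0_eq0 Ay0 => {}Ay0.
  suff -> : y = 0 by rewrite nrm0 mulr_ge0 ?nrm_ge0.
  apply: nrm0_eq0; apply/eqP.
  by rewrite -sqrf_eq0 -ripxx /rip -{1}Tx TA Ay0 linear0r.
have Agt0 : 0 < nrm (A y) by rewrite lt_neqAle eq_sym Ayn0 nrm_ge0.
pose t := (nrm (A y))^-1; have t0 : 0 < t by rewrite invr_gt0.
have : nrm (t%:C *: y) <= C.
  apply: BC; split; first exact: subspaceZ (range_subspace lT) Ty.
  by rewrite linZ// nrmZr gtr0_norm// mulVf.
rewrite nrmZr gtr0_norm// ler_pdivrMl// mulrC => /le_trans; apply.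
by rewrite ler_wpM2r ?nrm_ge0// ler_norm.
Qed.

Lemma adjoint_range_closed T A : adjoint_pair T A -> closed (range T) ->
  closed (range A).
Proof.
move=> TA clT; have [c c0 cA] := adjoint_bounded_below TA clT.
have [bT bA hTA] := TA; have lT := bT.1; have lA := bA.1.
have [_ [C C0 AC]] := (bounded_opP A).1 bA.
have [P sP PT] := orth_proj_exists (range_subspace lT) clT.
have AP y : A (P y) = A y.
  have [[lP _] PP _] := sP; apply: (@absorb_idempotent A P y) => // z.
  exact: (sym_idempotent_ker z (adjoint_pairC TA) sP PT).1.
apply/closedP_nrm => x xA.
pose q : R := 2^-1; have q01 : 0 <= q < 1 by apply/andP; rewrite /q; split; lra.
have q_gt0 n : 0 < q ^+ n by rewrite exprn_gt0// /q invr_gt0.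
(* Since $AP=A$, preimages may be projected onto $R(T)$, where the lower bound for [A] makes them a
   Cauchy sequence. *)
have /choice[y yP] n : exists y, range T y /\ nrm (x - A y) <= q ^+ n.
  have [_ [z _ <-] lt] := xA _ (q_gt0 n); exists (P z).
  by split; [rewrite -PT; exists z | rewrite AP ltW].
have yS n : nrm (y n.+1 - y n) <= (2 * c) * q ^+ n.
  apply: le_trans (cA _ _) _.
    by apply: subspaceB; [exact: range_subspace | exact: (yP _).1..].
  rewrite (mulrC 2 c) -mulrA; apply: ler_wpM2l => //.
  have -> : A (y n.+1 - y n) = (x - A (y n)) - (x - A (y n.+1)).
    by rewrite (linB lA) opprB [RHS]addrC addrA subrK.
  apply: le_trans (nrmD _ _) _; rewrite nrmN.
  have := (yP n).2; have := (yP n.+1).2; rewrite exprS.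
  by have := q_gt0 n; rewrite {2}/q; lra.
have [|l yl] := geometric_cvg _ q01 yS; first by rewrite mulr_ge0.
exists l => //; apply/esym/eqP; rewrite -subr_eq0; apply/eqP/nrm0_eq0/eqP.
rewrite eq_le nrm_ge0 andbT.
apply: (@le0_small R _ (1 + C * (2 * c / (1 - q))) q q01) => n.
have -> : x - A l = (x - A (y n)) - A (l - y n).
  by rewrite (linB lA) opprB addrA subrK.
apply: le_trans (nrmD _ _) _; rewrite nrmN mulrDl mul1r.
apply: lerD; first exact: (yP n).2.
by apply: le_trans (AC _) _; rewrite -mulrA ler_wpM2l.
Qed.

(** A vector orthogonal to $N(T)$ lies in $R(A)$, which is closed, so the preceding lower bound
    applies with [T] and [A] exchanged. *)
Lemma bounded_below T A : adjoint_pair T A -> closed (range T) ->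
  exists2 c : R, 0 <= c &
    forall x, (forall z, T z = 0 -> inner x z = 0) -> nrm x <= c * nrm (T x).
Proof.
move=> TA clT; have clA := adjoint_range_closed TA clT.
have [[lT _] [lA _] _] := TA.
have [c c0 cT] := adjoint_bounded_below (adjoint_pairC TA) clA.
exists c => // x xT; apply: cT.
have [E sE EA] := orth_proj_exists (range_subspace lA) clA.
have [[lE _] EE Es] := sE.
rewrite -EA; exists x => //; apply/esym/eqP; rewrite -subr_eq0; apply/eqP.
have E0 : E (x - E x) = 0 by rewrite linB// EE subrr.
have /xT x0 : T (x - E x) = 0 by apply/(sym_idempotent_ker _ TA sE EA).
apply: nrm0_eq0; apply/eqP; rewrite -sqrf_eq0 -ripxx {1}ripBl /rip x0 Es E0.
by rewrite linear0r subrr.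
Qed.

Lemma adjoint_proj T : bounded_op T -> closed (range T) ->
  let E := orth_proj_onto (range (adjoint T)) in
  [/\ sym_idempotent E, range E = range (adjoint T) &
      forall x, E x = 0 <-> T x = 0].
Proof.
move=> bT clT E; have TA := adjointP bT; have [_ [lA _] _] := TA.
have clA := adjoint_range_closed TA clT.
have [sE EA] := orth_proj_ontoP (range_subspace lA) clA.
by split=> // x; exact: sym_idempotent_ker TA sE EA.
Qed.

End ClosedRange.

(** * Spectral radius of a strict contraction *)

Section Spectrum.
Variables (R : realType) (H : hilbertType R).
Implicit Types (B : H -> H) (x y : H) (c : R).

(* Solving [B x - l *: x = y] amounts to finding a fixed point of the
   contraction [x |-> l^-1 *: (B x - y)]. *)
Lemma shifted_contraction_invertible B c (l : R[i]) :
  linear B -> 0 <= c -> (forall x, nrm (B x) <= c * nrm x) ->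
  c < complex.Re `|l| -> invertible_op (B - l *: (idfun : H -> H)).
Proof.
move=> lB c0 Bc cl; set k := complex.Re `|l| in cl.
have k0 : 0 < k by exact: le_lt_trans cl.
have ln0 : l != 0.
  by rewrite -normr_eq0 Re_normc -/k (inj_eq (@complexI R) k 0) gt_eqF.
pose D : H -> H := B - l *: (idfun : H -> H).
have DE x : D x = B x - l *: x by [].
have kV : complex.Re `|l^-1| = k^-1.
  apply: (@complexI R); rewrite -Re_normc normfV Re_normc -/k.
  by rewrite fmorphV.
have lD : linear D.
  move=> a x y; rewrite !DE lB scalerDr opprD addrACA scalerBr.
  by rewrite !scalerA mulrC.
(* This lower bound gives injectivity of [D] and the bound [(k - c)^-1] for its inverse. *)
have below x : (k - c) * nrm x <= nrm (D x).
  have := nrmD (B x) (- D x); rewrite nrmN DE opprB addrC subrK nrmZ -/k.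
  by have := Bc x; lra.
have kc : 0 < k - c by rewrite subr_gt0.
have Dinj x : D x = 0 -> x = 0.
  move=> Dx; have := below x; rewrite Dx nrm0 pmulr_rle0// => x0.
  by apply: nrm0_eq0; apply/eqP; rewrite eq_le x0 nrm_ge0.
pose q := c / k; have q01 : 0 <= q < 1.
  by rewrite /q divr_ge0 ?(ltW k0)//= ltr_pdivrMr// mul1r.
have /choice[G GP] y : exists x, D x = y.
  pose F x := l^-1 *: (B x - y).
  have FB x x' : nrm (F x - F x') <= q * nrm (x - x').
    rewrite /F -scalerBr opprB addrA subrK nrmZ kV -linB//.
    by rewrite /q mulrAC ler_pdivlMr// mulrAC mulVf ?gt_eqF// mul1r.
  pose u n := iter n F 0.
  have uS n : nrm (u n.+1 - u n) <= nrm (u 1%N - u 0%N) * q ^+ n.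
    elim: n => [|n ih]; first by rewrite expr0 mulr1.
    apply: le_trans (FB _ _) _; rewrite exprS mulrCA.
    by apply: ler_wpM2l ih; case/andP: q01.
  have [l' ul] := geometric_cvg (nrm_ge0 _) q01 uS.
  set K := _ / _ in ul.
  have Fl : l' = F l'.
    apply/eqP; rewrite -subr_eq0; apply/eqP/nrm0_eq0/eqP.
    rewrite eq_le nrm_ge0 andbT.
    apply: (@le0_small R _ (K * q + K * q) q q01) => n.
    have -> : l' - F l' = (l' - u n.+1) + (F (u n) - F l').
      by rewrite addrA subrK.
    apply: le_trans (nrmD _ _) _; rewrite mulrDl; apply: lerD.
      by apply: le_trans (ul _) _; rewrite exprS mulrA.
    apply: le_trans (FB _ _) _; rewrite -(mulrA K) (mulrCA K) nrmB.
    by apply: ler_wpM2l (ul n); case/andP: q01.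
  exists l'; rewrite DE; have : l *: l' = B l' - y.
    by rewrite {1}Fl /F scalerA divff// scale1r.
  by move=> ->; rewrite opprB addrC subrK.
have GD x : G (D x) = x.
  by apply/eqP; rewrite -subr_eq0; apply/eqP/Dinj; rewrite linB// GP subrr.
exists G; split; [|exact/funext|exact/funext].
apply/bounded_opP; split.
  by move=> a x y; rewrite -[RHS]GD lD !GP.
exists (k - c)^-1; first by rewrite invr_ge0 ltW.
by move=> x; rewrite mulrC ler_pdivlMr// mulrC -[in leRHS](GP x).
Qed.

(** No scalar of modulus above [c] is spectral, so the supremum is at most [c], which keeps the
    inequality strict. *)
Lemma spectral_radius_lt1 B c : linear B -> 0 <= c < 1 ->
  (forall x, nrm (B x) <= c * nrm x) -> (spectral_radius B < 1)%E.
Proof.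
move=> lB /andP[c0 c1] Bc.
apply: (@le_lt_trans _ _ c%:E); last by rewrite lte_fin.
apply: ge_ereal_sup => _ [l sl <-]; rewrite lee_fin leNgt; apply/negP => cl.
by apply: sl; exact: shifted_contraction_invertible cl.
Qed.

Lemma op_norm_lt1 B : linear B -> (op_norm B < 1)%E ->
  exists2 c, 0 <= c < 1 & forall x, nrm (B x) <= c * nrm x.
Proof.
move=> lB B1.
have ub x : nrm x <= 1 -> ((nrm (B x))%:E <= op_norm B)%E.
  move=> x1; apply: ereal_sup_ubound; exists x => //=.
  by rewrite norm_nrm lecR.
(* The value at 0 rules out [-oo], so the operator norm is a nonnegative real. *)
have := ub 0; rewrite nrm0 lin0// nrm0 => /(_ ler01) B0.
have fB : op_norm B \is a fin_num.
  by rewrite ge0_fin_numE// (lt_trans B1)// ltry.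
rewrite -(fineK fB) in ub B1 B0; set c := fine _ in ub B1 B0.
exists c => [|x]; first by rewrite -!lee_fin B0.
have [x0|xn0] := eqVneq (nrm x) 0.
  by rewrite (nrm0_eq0 x0) lin0// nrm0 mulr0.
have xgt0 : 0 < nrm x by rewrite lt_neqAle eq_sym xn0 nrm_ge0.
have := ub ((nrm x)^-1%:C *: x).
rewrite linZ// !nrmZr gtr0_norm ?invr_gt0// mulVf// => /(_ (lexx _)).
by rewrite lee_fin ler_pdivrMl// mulrC.
Qed.

End Spectrum.

(** * Oblique projections, their Moore-Penrose inverses, and convergence *)

Section ProperSplitting.
Variables (R : realType) (H : hilbertType R).
Implicit Types (x y : H) (S T P Q E F X : H -> H).

Lemma bounded_opB S T : bounded_op S -> bounded_op T -> bounded_op (S - T).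
Proof.
move=> /bounded_opP[lS [C C0 SC]] /bounded_opP[lT [D D0 TD]].
apply/bounded_opP; split=> [a x y|].
  change (S (a *: x + y) - T (a *: x + y) = a *: (S x - T x) + (S y - T y)).
  by rewrite lS lT scalerBr opprD addrACA.
exists (C + D) => [|x]; first exact: addr_ge0.
apply: le_trans (nrmD _ _) _; rewrite nrmN mulrDl.
exact: lerD (SC x) (TD x).
Qed.

Lemma bounded_op_comp S T : bounded_op S -> bounded_op T -> bounded_op (S \o T).
Proof.
move=> [lS cS] [lT cT]; split=> [a x y|x]; first by rewrite /= lT lS.
by apply: continuous_comp; [exact: cT | exact: cS].
Qed.

(** [Q] is first built algebraically from the direct sum. With $U=FP$ one has $UQ=F$, so a lower
    bound for [U] on the range of [Q] gives $\|Qx\|\le c\|Fx\|\le c\|x\|$. *)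
Lemma Qproj_spec T : split_op T ->
  [/\ bounded_idempotent (Qproj T), range (Qproj T) = range T &
      ker (Qproj T) = ker T].
Proof.
move=> [bT clT [MN sum]]; have [lT _] := bT.
have TQ x : exists m, range T m /\ T (x - m) = 0.
  have [m [n [Tm Tn ->]]] := sum x.
  by exists m; split=> //; rewrite addrC addKr.
have triv x : range T x -> T x = 0 -> x = 0.
  by move=> Tx Tx0; have : (range T `&` ker T) x by []; rewrite MN.
have /choice[Q QP] := TQ.
have QT x := (QP x).1; have Q0 x := (QP x).2.
have Quniq x m : range T m -> T (x - m) = 0 -> Q x = m.
  move=> Tm Txm; apply/eqP; rewrite -subr_eq0; apply/eqP/triv.
    exact: subspaceB (range_subspace lT) _ _.
  have -> : Q x - m = (x - m) - (x - Q x).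
    by rewrite opprB [RHS]addrC addrA subrK.
  by rewrite linB// Txm Q0 subrr.
have lQ : linear Q.
  move=> a x y; apply: Quniq; first exact: (range_subspace lT).2.
  by rewrite opprD addrACA -scalerBr lT !Q0 scaler0 addr0.
have Qid m : range T m -> Q m = m.
  by move=> Tm; apply: Quniq => //; rewrite subrr lin0.
have QQ x : Q (Q x) = Q x by exact: Qid.
have [sF FA FT] := adjoint_proj bT clT; have [[lF _] FF _] := sF.
have [P sP PT] := orth_proj_exists (range_subspace lT) clT.
have [[lP _] PP Ps] := sP.
set F := orth_proj_onto _ in sF FA FT lF FF.
have PQ x : P (Q x) = Q x by apply: range_idempotent; rewrite ?PT.
have FQ x : F (Q x) = F x.
  by apply/esym/eqP; rewrite -subr_eq0 -linB//; apply/eqP/FT.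
have bU : bounded_op (F \o P) by apply: bounded_op_comp; [case: sF | case: sP].
have UF : range (F \o P) = range (adjoint T).
  rewrite -FA; apply/seteqP; split=> _ [x _ <-]; first by exists (P x).
  by exists (Q x) => //=; rewrite PQ FQ.
have clU : closed (range (F \o P)).
  by rewrite UF; exact: adjoint_range_closed (adjointP bT) clT.
have [c c0 Uc] := bounded_below (adjointP bU) clU.
have bQ : bounded_op Q.
  apply/bounded_opP; split=> //; exists c => // x.
  apply: (@le_trans _ _ (c * nrm ((F \o P) (Q x)))).
    (* If $FPz=0$ then $Pz$ lies in $R(T)\cap N(T)$, hence vanishes; so $Qx=PQx$ is orthogonal to
       $z$. *)
    apply: Uc => z /= /FT TPz; rewrite -PQ Ps.
    have -> : P z = 0 by apply: triv TPz; rewrite -PT; exists z.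
    by rewrite linear0r.
  by rewrite /= PQ FQ ler_wpM2l// sym_idempotent_nrm.
have QI : [/\ bounded_idempotent Q, range Q = range T & ker Q = ker T].
  split.
  - by split=> //; apply/funext => x; exact: QQ.
  - by apply/seteqP; split=> [_ [x _ <-]//|m Tm]; exists m => //; exact: Qid.
  - apply/seteqP; split=> x; rewrite /ker/= => x0.
      by have := Q0 x; rewrite x0 subr0.
    by apply: Quniq; [exact: (range_subspace lT).1 | rewrite subr0].
by have := xgetPex (0 : H -> H) (ex_intro
  [set Q | [/\ bounded_idempotent Q, range Q = range T & ker Q = ker T]] Q QI).
Qed.

(** The products $QX$ and $XQ$ collapse to [P] and [F], which are self-adjoint; the Penrose
    equations follow. *)
Lemma moore_penrose_exists Q P F : bounded_idempotent Q ->
  sym_idempotent P -> sym_idempotent F -> range P = range Q ->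
  (forall x, F x = 0 <-> Q x = 0) ->
  let X := F \o P in
  bounded_op X /\ [/\ Q \o X \o Q = Q, X \o Q \o X = X,
        adjoint (Q \o X) = Q \o X & adjoint (X \o Q) = X \o Q].
Proof.
move=> [bQ /funeqP QQ] sP sF PQ FQ X.
have [bP PP _] := sP; have [bF FF _] := sF.
have [lQ _] := bQ; have [lF _] := bF.
have QF x : Q (F x) = Q x.
  by apply: (@absorb_idempotent _ _ Q F) => // z /FQ.
have FQE x : F (Q x) = F x.
  by apply: (@absorb_idempotent _ _ F Q) => // z /FQ.
have PQE x : P (Q x) = Q x by apply: range_idempotent; rewrite ?PQ.
have QPE x : Q (P x) = P x by apply: range_idempotent => //; rewrite -PQ.
have QX : Q \o X = P by apply/funext => x; rewrite /X/= QF QPE.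
have XQ : X \o Q = F by apply/funext => x; rewrite /X/= PQE FQE.
split; first exact: bounded_op_comp.
split.
- by apply/funext => x; rewrite QX/= PQE.
- by apply/funext => x; rewrite XQ /X/= FF.
- by rewrite QX; case/orth_projectionP: sP.
- by rewrite XQ; case/orth_projectionP: sF.
Qed.

(** As $QT=T$, the argument is $Q(x-Tx)$, so only the product $XQ$ has to be identified. *)
Lemma moore_penrose_Qproj T x : split_op T ->
  moore_penrose (Qproj T) (Qproj T x - T x) =
  orth_proj_onto (range (adjoint T)) (x - T x).
Proof.
move=> sT; have [bT clT _] := sT; have [lT _] := bT.
have [bQ QT kQ] := Qproj_spec sT.
have [sF _ FT] := adjoint_proj bT clT.
have [P sP PT] := orth_proj_exists (range_subspace lT) clT.
set Q := Qproj T in bQ QT kQ *; set F := orth_proj_onto _ in sF FT *.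
have QT0 z : Q z = 0 <-> T z = 0.
  by rewrite -[Q z = 0]/(ker Q z) kQ.
have FQ z : F z = 0 <-> Q z = 0 by rewrite FT QT0.
have := xgetPex (0 : H -> H) (ex_intro
  [set X | bounded_op X /\
    [/\ Q \o X \o Q = Q, X \o Q \o X = X,
        adjoint (Q \o X) = Q \o X & adjoint (X \o Q) = X \o Q]] _
  (moore_penrose_exists bQ sP sF (etrans PT (esym QT)) FQ)).
rewrite -[xget _ _]/(moore_penrose Q); set X := moore_penrose Q.
move=> [bX [/funeqP QXQ /funeqP XQX _ aXQ]].
have [lX _] := bX; have [[lQ cQ] /funeqP QQ] := bQ.
have sXQ : sym_idempotent (X \o Q).
  have bXQ : bounded_op (X \o Q) by exact: bounded_op_comp.
  split=> // [z|]; first exact: XQX.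
  exact/self_adjointP.
(* Both are symmetric idempotents with the kernel of [Q]. *)
have XQF : X \o Q = F.
  apply: sym_idempotent_uniq => // z; rewrite FQ /=; split=> [z0|->].
    by rewrite -QXQ/= z0 lin0.
  exact: lin0.
have QTE z : Q (T z) = T z.
  by apply: range_idempotent => //; rewrite QT; exists z.
by rewrite -[in LHS]QTE -linB// -XQF.
Qed.

Lemma linear_proj_idB E T : linear E -> linear T -> linear (E \o (idfun - T)).
Proof.
move=> lE lT a x y.
change (E (a *: x + y - T (a *: x + y)) = a *: E (x - T x) + E (y - T y)).
by rewrite lT opprD addrACA -scalerBr lE.
Qed.

Lemma Qproj_splitting_convergesP T c : split_op T -> 0 <= c < 1 ->
  (forall x, nrm (orth_proj_onto (range (adjoint T)) (x - T x)) <= c * nrm x) ->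
  Qproj_splitting_converges T.
Proof.
move=> sT c01 Fc; have [bT clT _] := sT; have [bQ QT kQ] := Qproj_spec sT.
have [[[lF _] _ _] _ _] := adjoint_proj bT clT; have [lT _] := bT.
split.
  split=> //; [exact: bQ.1 | exact: bounded_opB bQ.1 bT | by rewrite subKr].
have -> : moore_penrose (Qproj T) \o (Qproj T - T) =
    orth_proj_onto (range (adjoint T)) \o (idfun - T).
  by apply/funext => x; exact: moore_penrose_Qproj.
exact: spectral_radius_lt1 (linear_proj_idB lF lT) c01 Fc.
Qed.

(* With [E = P_{S^*}]: [S = TE], hence [E(I - S) = E(I - T)E]. *)
Lemma star_le_converges S T c : split_op S -> split_op T -> 0 <= c < 1 ->
  (forall x, nrm (orth_proj_onto (range (adjoint T)) (x - T x)) <= c * nrm x) ->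
  star_le S T -> Qproj_splitting_converges S.
Proof.
move=> sS sT c01 Fc [P [Q [[[[lP _] _] _] /orth_projectionP sQ SPT SQT]]].
have [_ QQ Qs] := sQ; move: SPT SQT => /funeqP SPT /funeqP SQT.
have [bS clS _] := sS; have [bT clT _] := sT.
have [_ _ hS] := adjointP bS; have [_ _ hT] := adjointP bT.
have [sE EA ES] := adjoint_proj bS clS; have [sF _ FT] := adjoint_proj bT clT.
apply: (Qproj_splitting_convergesP sS c01) => x.
set E := orth_proj_onto (range (adjoint S)) in sE EA ES *.
set F := orth_proj_onto _ in sF FT Fc.
have [[lE _] EE _] := sE; have [[lF _] FF _] := sF; have [lS _] := bS.
(* $S=TQ$ is the adjoint of $S^*=QT^*$. *)
have STQ y : S y = T (Q y).
  by apply/eqP; rewrite -subr_eq0; apply/eqP/inner_eq0 => z;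
    rewrite linearBl/= hS SQT hT Qs subrr.
have EF y : E (F y) = E y.
  apply: absorb_idempotent => // z /FT Tz.
  by apply/ES; rewrite SPT /= Tz lin0.
have STE y : S y = T (E y).
  have <- : Q (E y) = E y.
    have [z _ <-] : range (adjoint S) (E y) by rewrite -EA; exists y.
    by rewrite SQT/= QQ.
  rewrite -STQ; apply/esym/(@absorb_idempotent _ _ S E) => // z.
  by move=> /ES.
have -> : E (x - S x) = E (F (E x - T (E x))).
  by rewrite EF !linB// EE -STE.
apply: le_trans (sym_idempotent_nrm _ sE) _; apply: le_trans (Fc _) _.
by case/andP: c01 => c0 _; rewrite ler_wpM2l// sym_idempotent_nrm.
Qed.

(* With [E = P_{S^*}]: [EQ = E], hence [E(I - S) = E - EQT = E(I - T)]. *)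
Lemma sharp_le_converges S T c : split_op S -> split_op T -> 0 <= c < 1 ->
  (forall x, nrm (orth_proj_onto (range (adjoint T)) (x - T x)) <= c * nrm x) ->
  sharp_le S T -> Qproj_splitting_converges S.
Proof.
move=> sS sT c01 Fc [ST|[Q [[[lQ _] /funeqP QQ] _ kQ /funeqP SQT _]]].
  by apply: (Qproj_splitting_convergesP sS c01); rewrite ST.
have [bS clS _] := sS; have [bT clT _] := sT.
have [sE _ ES] := adjoint_proj bS clS; have [sF _ FT] := adjoint_proj bT clT.
apply: (Qproj_splitting_convergesP sS c01) => x.
set E := orth_proj_onto (range (adjoint S)) in sE ES *.
set F := orth_proj_onto _ in sF FT Fc.
have [[lE _] EE _] := sE; have [[lF _] FF _] := sF.
have EF y : E (F y) = E y.
  apply: absorb_idempotent => // z /FT Tz.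
  by apply/ES; rewrite SQT /= Tz lin0.
(* [Q], [S] and [E] have the same kernel. *)
have EQ y : E (Q y) = E y.
  apply: absorb_idempotent => // z Qz; apply/ES.
  by have : ker Q z by []; rewrite kQ.
have -> : E (x - S x) = E (F (x - T x)).
  by rewrite EF linB// [RHS]linB// SQT /= EQ.
exact: le_trans (sym_idempotent_nrm _ sE) (Fc _).
Qed.

End ProperSplitting.

Theorem proposition5p5 (R : realType) (H : hilbertType R) (S T : H -> H)
    (hS : split_op S) (hT : split_op T)
    (hnorm : (op_norm (orth_proj_onto (range (adjoint T)) \o (idfun - T))%R
              < 1)%E) :
  (star_le S T ->
     Qproj_splitting_converges T /\ Qproj_splitting_converges S) /\
  (sharp_le S T ->
     Qproj_splitting_converges T /\ Qproj_splitting_converges S).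
Proof.
have [bT clT _] := hT; have [[[lF _] _ _] _ _] := adjoint_proj bT clT.
have [c c01 Fc] := op_norm_lt1 (linear_proj_idB lF bT.1) hnorm.
have convT := Qproj_splitting_convergesP hT c01 Fc.
by split=> le; split=> //;
  [exact: star_le_converges Fc le | exact: sharp_le_converges Fc le].
Qed.
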